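(* Consider the one-dimensional Allen–Cahn equation $\partial_t\rho=-\mathcal{M}(\rho)(-\epsilon^2\partial_{xx}\rho+F'(\rho))$ with a general mobility $\mathcal{M}(\rho)>0$ and $F(\rho)=\frac14(\rho^2-1)^2$. Let $\eta\ge 0$ and suppose the time-step ratios satisfy $0<r_{k}\le r_{\max}$ for all $k$. Let $n\ge 1$, and let $x^{n+1}$ be obtained from $x^{n-1},x^n$ by the scheme $$ \begin{aligned} &\frac{(2r_{n+1}+1)(\rho_0'(X))^2}{2\tau_{n+1}(r_{n+1}+1)}\left(\ell_{n+1}^{-1}+\ell_n^{-1}\right)(x^{n+1}-x^n)-\eta\tau_{n+1}\partial_X\left(\log\frac{\partial x^{n+1}}{\partial X}-\log\frac{\partial x^{n}}{\partial X}\right)\\ &-\frac{r_{n+1}^2(\rho_0'(X))^2}{\tau_{n+1}(r_{n+1}+1)}\left(\Big(1+\frac{1}{2r_{n+1}}\Big)\ell_{n}^{-\frac12}-\frac{1}{2r_{n+1}}\ell_{n+1}^{-\frac12}\right)\left(\frac12\ell_{n-1}^{-\frac12}+\frac12\ell_{n}^{-\frac12}\right)(x^{n}-x^{n-1})\\ &=-\frac{\epsilon^2}{2}\partial_X\left(\rho_0'(X)\Big(\frac{\partial x^{n+1}}{\partial X}\Big)^{-1}\right)^2+\partial_XF(\rho_0(X)), \end{aligned} $$ where $\ell_k:=\frac{\partial x^k}{\partial X}\mathcal{M}(\rho_0(X))$. If $0<r_{\max}\le\frac32$, then the scheme is energy dissipative in the sense that $$ \begin{aligned} &E^{n+1}+\frac{r_{\max}}{2\tau_{n+1}(r_{\max}+1)}\left((\rho_0'(X))^2(\ell_{n+1}^{-1}+\ell_{n}^{-1})(x^{n+1}-x^{n}),\,x^{n+1}-x^{n}\right)\\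 &+\eta\tau_{n+1}\left(\log\frac{\partial x^{n+1}}{\partial X}-\log\frac{\partial x^{n}}{\partial X},\,\frac{\partial x^{n+1}}{\partial X}-\frac{\partial x^{n}}{\partial X}\right)\\ &\le E^{n}+\frac{r_{\max}}{2\tau_{n}(r_{\max}+1)}\left((\rho_0'(X))^2(\ell_{n-1}^{-1}+\ell_{n}^{-1})(x^{n}-x^{n-1}),\,x^{n}-x^{n-1}\right), \end{aligned} $$ where $$E^k=\int_{\Omega_0^{X}}\left(\frac{\epsilon^2}{2}\Big|\rho_0'(X)\Big(\frac{\partial x^k}{\partial X}\Big)^{-1}\Big|^2+F(\rho_0(X))\right)\frac{\partial x^k}{\partial X}\,\mathrm{d}X.$$
   Context: $\Omega_0^X=\Omega$ is a bounded interval with Lagrangian (reference) coordinate $X$; $\rho_0$ is the given initial datum as a function of $X$, and $\epsilon>0$ is a constant. Each $x^k=x^k(X)$ is a numerical approximation at time $t^k$ of the flow map $x(X,t)$; all maps satisfy the Dirichlet condition $x^k|_{\partial\Omega}=X|_{\partial\Omega}$, and $\frac{\partial x^k}{\partial X}>0$ on $\Omega$ (the flow maps are understood to have positive Jacobian, and all functions are regular enough for the expressions to make sense). Time steps: $\tau_k=t^k-t^{k-1}>0$, time-step ratios $r_{k+1}=\tau_{k+1}/\tau_k$ for $k\ge 1$, with uniform upper bound $r_{\max}$. $(\cdot,\cdot)$ is the $L^2(\Omega_0^X)$ inner product. *)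

(* Defs.v *)
From Stdlib Require Import Reals.
From Coquelicot Require Import Coquelicot.
Open Scope R_scope.

(** [Omega = (a, b)].  Functions of the reference coordinate are represented by
    total functions [R -> R] of which only the restriction to [[a, b]] matters;
    as a C^1 function on [[a, b]] extends (affinely) to a C^1 function on [R],
    two-sided derivatives at the endpoints lose no generality. *)

Definition F (s : R) : R := / 4 * (s ^ 2 - 1) ^ 2.

(** Meaningful for [k >= 1]. *)
Definition tau (t : nat -> R) (k : nat) : R := t k - t (k - 1)%nat.

(** Meaningful for [k >= 2]. *)
Definition ratio (t : nat -> R) (k : nat) : R := tau t k / tau t (k - 1)%nat.

Definition inner (a b : R) (f g : R -> R) : R :=
  RInt (fun X => f X * g X) a b.

(** The second derivative occurs only pointwise, inside [Omega], in the scheme;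
    the first one occurs in integrals over [Omega]. *)
Definition regular (a b : R) (f : R -> R) : Prop :=
  (forall X, a <= X <= b -> ex_derive f X /\ continuous (Derive f) X) /\
  (forall X, a < X < b -> ex_derive (Derive f) X).

(** The Jacobian is positive up to the boundary, so that its inverse and its
    logarithm are bounded on [Omega]. *)
Definition flow_map (a b : R) (x : R -> R) : Prop :=
  regular a b x /\ x a = a /\ x b = b /\
  (forall X, a <= X <= b -> 0 < Derive x X).

Definition ell (M rho0 xk : R -> R) (X : R) : R := Derive xk X * M (rho0 X).

Definition energy (a b eps : R) (rho0 xk : R -> R) : R :=
  RInt (fun X => (eps ^ 2 / 2 * Rabs (Derive rho0 X * / Derive xk X) ^ 2
                  + F (rho0 X)) * Derive xk X) a b.

(** The scheme at the point [X]; [xm], [x0], [xp] stand for the maps at times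
    [t^(n-1)], [t^n], [t^(n+1)], and [dt], [r] for [tau_(n+1)], [r_(n+1)]. *)
Definition scheme_at (eps eta dt r : R) (M rho0 xm x0 xp : R -> R) (X : R)
    : Prop :=
  (2 * r + 1) * Derive rho0 X ^ 2 / (2 * dt * (r + 1))
    * (/ ell M rho0 xp X + / ell M rho0 x0 X) * (xp X - x0 X)
  - eta * dt * Derive (fun Y => ln (Derive xp Y) - ln (Derive x0 Y)) X
  - r ^ 2 * Derive rho0 X ^ 2 / (dt * (r + 1))
    * ((1 + 1 / (2 * r)) * Rpower (ell M rho0 x0 X) (- (1 / 2))
       - 1 / (2 * r) * Rpower (ell M rho0 xp X) (- (1 / 2)))
    * (1 / 2 * Rpower (ell M rho0 xm X) (- (1 / 2))
       + 1 / 2 * Rpower (ell M rho0 x0 X) (- (1 / 2)))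
    * (x0 X - xm X)
  = - (eps ^ 2 / 2) * Derive (fun Y => (Derive rho0 Y * / Derive xp Y) ^ 2) X
    + Derive (fun Y => F (rho0 Y)) X.

(* Main.v *)
Require Import Defs.
From Stdlib Require Import Reals Lra Lia.
From Coquelicot Require Import Coquelicot.
Open Scope R_scope.

(** Test the scheme with [w = x^(n+1) - x^n], which vanishes at both endpoints.
    Three facts give the estimate.

    - Integration by parts.  Collect the terms of the scheme under [d/dX] into
      [G = - eta tau (ln y - ln z) + (eps^2/2) (rho0'/y)^2 - F(rho0)], where [y]
      and [z] are the Jacobians of [x^(n+1)] and [x^n].  The scheme says that
      [G'] is minus the kinetic terms.  The second derivatives in [G'] exist
      only pointwise and need not be integrable one by one, but the kinetic terms
      are continuous up to the boundary, hence so is [G'] as a whole, and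
      [(G w)'] integrates to [0] ([is_RInt_derive_interior]).

    - Convexity.  In Lagrangian coordinates the energy density is
      [(eps^2/2) rho0'^2 / y + F(rho0) y], convex in [y], so its increment is at
      most its slope at the new Jacobian times [w' = y - z]
      ([energy_density_increment]).  That slope is what appears in [- G].

    - A quadratic form.  After multiplication by [w], the kinetic terms dominate
      the increment of the modified kinetic energy: a discriminant condition on
      [r] and [rmax] makes the quadratic form in the two successive displacements
      nonnegative ([kinetic_increment]).

    Adding the last two gives an inequality between integrands, in which
    [- (G w)'] occurs with integral [0]; integrating it gives the theorem. *)

(** * Algebraic inequalities *)

(** The arithmetic-geometric mean bound
    [(A alpha + B beta)^2 >= 4 A B alpha beta >= (C gamma)^2]. *)
Lemma quadratic_form_nonneg (A B C K alpha beta gamma : R) :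
  0 <= A -> 0 <= B -> 0 <= alpha -> 0 <= beta ->
  gamma ^ 2 <= K * (alpha * beta) -> C ^ 2 * K <= 4 * (A * B) ->
  C * gamma <= A * alpha + B * beta.
Proof.
  intros hA hB halpha hbeta hgamma hdisc.
  assert (hab : 0 <= alpha * beta) by (apply Rmult_le_pos; assumption).
  assert (h0 : 0 <= A * alpha + B * beta)
    by (apply Rplus_le_le_0_compat; apply Rmult_le_pos; assumption).
  assert (h1 : C ^ 2 * gamma ^ 2 <= C ^ 2 * (K * (alpha * beta)))
    by (apply Rmult_le_compat_l; [apply pow2_ge_0 | assumption]).
  assert (h2 : C ^ 2 * K * (alpha * beta) <= 4 * (A * B) * (alpha * beta))
    by (apply Rmult_le_compat_r; assumption).
  assert (h3 : 0 <= (A * alpha - B * beta) ^ 2) by apply pow2_ge_0.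
  apply Rsqr_incr_0_var; [unfold Rsqr | assumption].
  nra.
Qed.

(** The constant [2 r^2 + 2 r + 1] is [((2 r + 1)^2 + 1) / 2], from the
    Cauchy-Schwarz bounds of [(2 r + 1) q - p] by [p^2 + q^2] and of
    [(m + q) / 2] by [m^2 + q^2]. *)
Lemma cross_term_sqr_le (r p q m v w : R) :
  (((2 * r + 1) * q - p) * ((m + q) / 2) * v * w) ^ 2
  <= (2 * r ^ 2 + 2 * r + 1)
     * (((p ^ 2 + q ^ 2) * w ^ 2) * ((m ^ 2 + q ^ 2) * v ^ 2)).
Proof.
  set (c1 := ((2 * r + 1) * q - p) ^ 2).
  set (c2 := ((m + q) / 2) ^ 2).
  assert (h1 : c1 <= ((2 * r + 1) ^ 2 + 1) * (p ^ 2 + q ^ 2)).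
  { unfold c1.
    assert (h := pow2_ge_0 (q + (2 * r + 1) * p)). nra. }
  assert (h2 : c2 <= (m ^ 2 + q ^ 2) / 2).
  { unfold c2. assert (h := pow2_ge_0 (m - q)). nra. }
  assert (h3 : c1 * c2
               <= ((2 * r + 1) ^ 2 + 1) * (p ^ 2 + q ^ 2)
                  * ((m ^ 2 + q ^ 2) / 2))
    by (apply Rmult_le_compat; unfold c1, c2 in *; auto using pow2_ge_0).
  apply (Rmult_le_compat_r (v ^ 2 * w ^ 2)) in h3;
    [| apply Rmult_le_pos; apply pow2_ge_0].
  unfold c1, c2 in h3.
  lra.
Qed.

(** Multiplied by [2 dt], with [sigma = r / (r + 1)] and [s = R / (R + 1)], the
    claim is that the form with diagonal coefficients [1 + sigma - s] and [s r]
    and off-diagonal coefficient [sigma] is nonnegative.  Since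
    [(1 + sigma - s) s - sigma = (s - sigma) (1 - s) >= 0], the discriminant is
    controlled by the case [R = r], where the condition reads
    [2 r^2 + 2 r + 1 <= 4 (r + 1)]; it holds for [r <= 3/2]. *)
Lemma kinetic_increment (r R dt p q m v w : R) :
  0 < dt -> 0 < r <= R -> R <= 3 / 2 ->
  R / (2 * dt * (R + 1)) * ((p ^ 2 + q ^ 2) * w ^ 2)
  - R / (2 * (dt / r) * (R + 1)) * ((m ^ 2 + q ^ 2) * v ^ 2)
  <= ((2 * r + 1) / (2 * dt * (r + 1)) * (p ^ 2 + q ^ 2) * w
      - r ^ 2 / (dt * (r + 1))
        * ((1 + 1 / (2 * r)) * q - 1 / (2 * r) * p)
        * (1 / 2 * m + 1 / 2 * q) * v) * w.
Proof.
  intros hdt [hr hrR] hR.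
  set (sigma := r / (r + 1)). set (s := R / (R + 1)).
  assert (hsigma : sigma * (r + 1) = r) by (unfold sigma; field; lra).
  assert (hs : s * (R + 1) = R) by (unfold s; field; lra).
  assert (hsigma0 : 0 < sigma) by (apply Rdiv_lt_0_compat; lra).
  assert (hs0 : 0 < s) by (apply Rdiv_lt_0_compat; lra).
  assert (hs1 : s < 1) by nra.
  assert (hsigmas : sigma <= s).
  { assert (h : s - sigma = (R - r) * / ((R + 1) * (r + 1)))
      by (unfold s, sigma; field; lra).
    assert (0 <= (R - r) * / ((R + 1) * (r + 1))); [| lra].
    apply Rmult_le_pos; [lra |].
    apply Rlt_le, Rinv_0_lt_compat, Rmult_lt_0_compat; lra. }
  assert (hdisc : sigma ^ 2 * (2 * r ^ 2 + 2 * r + 1)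
                  <= 4 * ((1 + sigma - s) * (s * r))).
  { assert (h1 : sigma * (2 * r ^ 2 + 2 * r + 1) <= 4 * r).
    { replace (4 * r) with (sigma * (4 * (r + 1))) by lra.
      apply Rmult_le_compat_l; nra. }
    assert (h2 : sigma <= (1 + sigma - s) * s).
    { assert (h := Rmult_le_pos (s - sigma) (1 - s) ltac:(lra) ltac:(lra)).
      lra. }
    apply (Rmult_le_compat_l sigma) in h1; [| lra].
    apply (Rmult_le_compat_r r) in h2; [| lra].
    lra. }
  assert (hform := quadratic_form_nonneg (1 + sigma - s) (s * r) sigma _
    ((p ^ 2 + q ^ 2) * w ^ 2) ((m ^ 2 + q ^ 2) * v ^ 2) _
    ltac:(lra) ltac:(apply Rmult_le_pos; lra)
    ltac:(apply Rmult_le_pos; [apply Rplus_le_le_0_compat |]; apply pow2_ge_0)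
    ltac:(apply Rmult_le_pos; [apply Rplus_le_le_0_compat |]; apply pow2_ge_0)
    (cross_term_sqr_le r p q m v w) hdisc).
  apply (Rmult_le_compat_l (/ (2 * dt))) in hform;
    [| apply Rlt_le, Rinv_0_lt_compat; lra].
  apply Rminus_le_0 in hform. apply Rminus_le_0.
  eapply Rle_trans; [exact hform | right].
  unfold s, sigma. field. lra.
Qed.

(** [y -> 1 / y] lies above its tangent at [y]. *)
Lemma energy_density_increment (eps rho f y z : R) :
  0 < y -> 0 < z ->
  (eps ^ 2 / 2 * Rabs (rho * / y) ^ 2 + f) * y
  - (eps ^ 2 / 2 * Rabs (rho * / z) ^ 2 + f) * z
  <= (- (eps ^ 2 / 2 * (rho * / y) ^ 2) + f) * (y - z).
Proof.
  intros hy hz. rewrite !pow2_abs.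
  apply Rminus_le_0.
  replace (_ - _) with (eps ^ 2 / 2 * (rho * (y - z) * / y) ^ 2 * / z)
    by (field; lra).
  apply Rmult_le_pos; [| apply Rlt_le, Rinv_0_lt_compat; assumption].
  assert (h1 := pow2_ge_0 eps). assert (h2 := pow2_ge_0 (rho * (y - z) * / y)).
  apply Rmult_le_pos; lra.
Qed.

Lemma Rpower_minus_half_sqr (u : R) :
  0 < u -> Rpower u (- (1 / 2)) ^ 2 = / u.
Proof.
  intros hu. simpl. rewrite Rmult_1_r, <- Rpower_plus.
  replace (- (1 / 2) + - (1 / 2)) with (- (1)) by lra.
  rewrite Rpower_Ropp, Rpower_1; auto.
Qed.

(** * Continuity and integration on a closed interval *)

Lemma continuous_Rplus (f g : R -> R) (X : R) :
  continuous f X -> continuous g X -> continuous (fun Y => f Y + g Y) X.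
Proof. intros hf hg. exact (continuous_plus f g X hf hg). Qed.

Lemma continuous_Rminus (f g : R -> R) (X : R) :
  continuous f X -> continuous g X -> continuous (fun Y => f Y - g Y) X.
Proof. intros hf hg. exact (continuous_minus f g X hf hg). Qed.

Lemma continuous_Ropp (f : R -> R) (X : R) :
  continuous f X -> continuous (fun Y => - f Y) X.
Proof. intros hf. exact (continuous_opp f X hf). Qed.

Lemma continuous_Rmult (f g : R -> R) (X : R) :
  continuous f X -> continuous g X -> continuous (fun Y => f Y * g Y) X.
Proof. intros hf hg. exact (continuous_mult f g X hf hg). Qed.

Lemma continuous_pow (f : R -> R) (k : nat) (X : R) :
  continuous f X -> continuous (fun Y => f Y ^ k) X.
Proof.
  intros hf. induction k as [| k IH]; simpl.
  - apply continuous_const.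
  - apply continuous_Rmult; assumption.
Qed.

Lemma continuous_ln_comp (f : R -> R) (X : R) :
  continuous f X -> 0 < f X -> continuous (fun Y => ln (f Y)) X.
Proof.
  intros hf h0. apply (continuous_comp f ln); [assumption |].
  apply (ex_derive_continuous (V := R_NormedModule)). exists (/ f X). apply is_derive_ln. assumption.
Qed.

Lemma continuous_Rpower_comp (f : R -> R) (c X : R) :
  continuous f X -> 0 < f X -> continuous (fun Y => Rpower (f Y) c) X.
Proof.
  intros hf h0. apply (continuous_comp (fun Y => c * ln (f Y)) exp).
  - apply continuous_Rmult; [apply continuous_const |].
    apply continuous_ln_comp; assumption.
  - apply (ex_derive_continuous (V := R_NormedModule)). exists (exp (c * ln (f X))). apply is_derive_exp.
Qed.

(** Extending [h] by constants outside [[a, b]] makes it continuous on the whole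
    line, so that its primitive is differentiable at the endpoints too; by the
    mean value theorem, that primitive differs from [g] by a constant. *)
Lemma is_RInt_derive_interior (g h : R -> R) (a b : R) :
  a < b ->
  (forall X, a <= X <= b -> continuous g X) ->
  (forall X, a <= X <= b -> continuous h X) ->
  (forall X, a < X < b -> is_derive g X (h X)) ->
  is_RInt h a b (g b - g a).
Proof.
  intros hab hg hh hd.
  destruct (C0_extension_le h a b) as [h' [hcont heq]].
  { intros X hX. exact (hh X hX). }
  assert (hcont' : forall X, continuous h' X) by (intro X; apply hcont).
  assert (hint : forall c d, ex_RInt h' c d)
    by (intros c d; apply (ex_RInt_continuous h'); auto).
  assert (hprim : forall X, is_derive (RInt h' a) X (h' X)).
  { intro X. apply (is_derive_RInt h' (RInt h' a) a X); [| apply hcont'].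
    apply filter_forall. intro Y.
    exact (RInt_correct _ _ _ (hint a Y)). }
  destruct (MVT_gen (fun X => RInt h' a X - g X) a b (fun _ => 0))
    as [c [_ hc]].
  - intros X. rewrite Rmin_left, Rmax_right by lra. intro hX.
    replace 0 with (h' X - h X) by (rewrite heq by lra; ring).
    apply (is_derive_minus (RInt h' a) g); [apply hprim | apply hd; assumption].
  - intros X. rewrite Rmin_left, Rmax_right by lra. intro hX.
    apply continuity_pt_filterlim.
    apply (continuous_Rminus (RInt h' a) g); [| apply hg; assumption].
    apply (ex_derive_continuous (V := R_NormedModule)). exists (h' X). apply hprim.
  - assert (h0 : RInt h' a a = 0) by exact (RInt_point a h').
    replace (g b - g a) with (RInt h' a b) by lra.
    apply is_RInt_ext with h'; [| exact (RInt_correct _ _ _ (hint a b))].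
    intros X. rewrite Rmin_left, Rmax_right by lra. intro hX.
    apply heq. lra.
Qed.

(** * The scheme *)

(** The left-hand side of the scheme without its [eta] term. *)
Definition kinetic (dt r : R) (M rho0 xm x0 xp : R -> R) (X : R) : R :=
  (2 * r + 1) * Derive rho0 X ^ 2 / (2 * dt * (r + 1))
    * (/ ell M rho0 xp X + / ell M rho0 x0 X) * (xp X - x0 X)
  - r ^ 2 * Derive rho0 X ^ 2 / (dt * (r + 1))
    * ((1 + 1 / (2 * r)) * Rpower (ell M rho0 x0 X) (- (1 / 2))
       - 1 / (2 * r) * Rpower (ell M rho0 xp X) (- (1 / 2)))
    * (1 / 2 * Rpower (ell M rho0 xm X) (- (1 / 2))
       + 1 / 2 * Rpower (ell M rho0 x0 X) (- (1 / 2)))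
    * (x0 X - xm X).

(** The quantity under the spatial derivative in the scheme. *)
Definition potential (eps eta dt : R) (rho0 x0 xp : R -> R) (X : R) : R :=
  - (eta * dt) * (ln (Derive xp X) - ln (Derive x0 X))
  + eps ^ 2 / 2 * (Derive rho0 X * / Derive xp X) ^ 2 - F (rho0 X).

Section Interval.

Context (a b : R) (M rho0 : R -> R).
Context (hrho0 : regular a b rho0).
Context (hM : forall X, a <= X <= b ->
  0 < M (rho0 X) /\ continuous M (rho0 X)).

Lemma regular_continuous (f : R -> R) (X : R) :
  regular a b f -> a <= X <= b -> continuous f X.
Proof.
  intros hf hX. apply (ex_derive_continuous f). apply hf. assumption.
Qed.

Lemma regular_continuous_Derive (f : R -> R) (X : R) :
  regular a b f -> a <= X <= b -> continuous (Derive f) X.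
Proof. intros hf hX. apply hf. assumption. Qed.

Lemma ell_pos (y : R -> R) (X : R) :
  flow_map a b y -> a <= X <= b -> 0 < ell M rho0 y X.
Proof.
  intros hy hX. apply Rmult_lt_0_compat; [apply hy | apply hM]; assumption.
Qed.

Lemma continuous_ell (y : R -> R) (X : R) :
  flow_map a b y -> a <= X <= b -> continuous (ell M rho0 y) X.
Proof.
  intros hy hX. unfold ell. apply continuous_Rmult.
  - apply regular_continuous_Derive; [apply hy | assumption].
  - apply (continuous_comp rho0 M); [| apply hM; assumption].
    apply regular_continuous; assumption.
Qed.

(* The head symbol selects the lemma, so that unification never unfolds real
   constants or powers. *)
Ltac solve_continuous :=
  repeat match goal with
  | |- continuous (fun _ => ?c) _ => apply (continuous_const c)
  | |- continuous (fun _ => _ + _) _ => apply continuous_Rplus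
  | |- continuous (fun _ => _ - _) _ => apply continuous_Rminus
  | |- continuous (fun _ => - _) _ => apply continuous_Ropp
  | |- continuous (fun _ => _ * _) _ => apply continuous_Rmult
  | |- continuous (fun _ => _ ^ _) _ => apply continuous_pow
  | |- continuous (fun _ => / _) _ => apply continuous_Rinv_comp
  | |- continuous (fun _ => ln _) _ => apply continuous_ln_comp
  | |- continuous (fun _ => Rpower _ _) _ => apply continuous_Rpower_comp
  | |- continuous (fun Y => ell _ _ ?y Y) _ => apply (continuous_ell y)
  | |- continuous (ell _ _ ?y) _ => apply (continuous_ell y)
  | |- continuous (fun Y => Derive ?f Y) _ => apply (regular_continuous_Derive f)
  | |- continuous (Derive ?f) _ => apply (regular_continuous_Derive f)
  | |- continuous (fun Y => ?f Y) _ => apply (regular_continuous f)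
  | |- continuous ?f _ => is_var f; apply (regular_continuous f)
  | |- _ <> 0 => apply Rgt_not_eq
  | |- 0 < ell _ _ _ _ => apply ell_pos
  | |- ell _ _ _ _ > 0 => apply ell_pos
  | hy : flow_map a b ?y |- regular a b ?y => apply hy
  | hy : flow_map a b ?y |- 0 < Derive ?y _ => apply hy
  | hy : flow_map a b ?y |- Derive ?y _ > 0 => apply hy
  | _ => assumption
  end.

Lemma continuous_F_rho0 (X : R) :
  a <= X <= b -> continuous (fun Y => F (rho0 Y)) X.
Proof. intros hX. unfold F. solve_continuous. Qed.

Lemma continuous_kinetic (dt r : R) (xm x0 xp : R -> R) (X : R) :
  flow_map a b xm -> flow_map a b x0 -> flow_map a b xp -> a <= X <= b ->
  continuous (kinetic dt r M rho0 xm x0 xp) X.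
Proof.
  intros hm h0 hp hX. unfold kinetic, Rdiv. solve_continuous.
Qed.

Lemma continuous_potential (eps eta dt : R) (x0 xp : R -> R) (X : R) :
  flow_map a b x0 -> flow_map a b xp -> a <= X <= b ->
  continuous (potential eps eta dt rho0 x0 xp) X.
Proof.
  intros h0 hp hX. unfold potential.
  apply continuous_Rminus; [| apply continuous_F_rho0; assumption].
  solve_continuous.
Qed.

Lemma ex_RInt_energy (eps : R) (y : R -> R) :
  a < b -> flow_map a b y ->
  ex_RInt (fun X => (eps ^ 2 / 2 * Rabs (Derive rho0 X * / Derive y X) ^ 2
                     + F (rho0 X)) * Derive y X) a b.
Proof.
  intros hab hy.
  apply ex_RInt_ext with
    (fun X => (eps ^ 2 / 2 * (Derive rho0 X * / Derive y X) ^ 2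
               + F (rho0 X)) * Derive y X).
  { intros X _. rewrite pow2_abs. reflexivity. }
  apply (ex_RInt_continuous (V := R_CompleteNormedModule)).
  intros X. rewrite Rmin_left, Rmax_right by lra. intro hX.
  apply continuous_Rmult; [apply continuous_Rplus |].
  - solve_continuous.
  - apply continuous_F_rho0; assumption.
  - solve_continuous.
Qed.

Lemma ex_RInt_kinetic_energy (y z y' z' : R -> R) :
  a < b -> flow_map a b y -> flow_map a b z ->
  flow_map a b y' -> flow_map a b z' ->
  ex_RInt (fun X => Derive rho0 X ^ 2 * (/ ell M rho0 y X + / ell M rho0 z X)
                    * (y' X - z' X) * (y' X - z' X)) a b.
Proof.
  intros hab hy hz hy' hz'.
  apply (ex_RInt_continuous (V := R_CompleteNormedModule)).
  intros X. rewrite Rmin_left, Rmax_right by lra. intro hX.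
  solve_continuous.
Qed.

Lemma ex_RInt_log_dissipation (y z : R -> R) :
  a < b -> flow_map a b y -> flow_map a b z ->
  ex_RInt (fun X => (ln (Derive y X) - ln (Derive z X))
                    * (Derive y X - Derive z X)) a b.
Proof.
  intros hab hy hz.
  apply (ex_RInt_continuous (V := R_CompleteNormedModule)).
  intros X. rewrite Rmin_left, Rmax_right by lra. intro hX.
  solve_continuous.
Qed.

Lemma is_derive_potential (eps eta dt r : R) (xm x0 xp : R -> R) (X : R) :
  flow_map a b x0 -> flow_map a b xp -> a < X < b ->
  scheme_at eps eta dt r M rho0 xm x0 xp X ->
  is_derive (potential eps eta dt rho0 x0 xp) X
    (- kinetic dt r M rho0 xm x0 xp X).
Proof.
  intros h0 hp hX hs.
  assert (hX' : a <= X <= b) by lra.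
  assert (h0pos : 0 < Derive x0 X) by (apply h0; assumption).
  assert (hppos : 0 < Derive xp X) by (apply hp; assumption).
  assert (d0 : ex_derive (Derive x0) X) by (apply h0; assumption).
  assert (dp : ex_derive (Derive xp) X) by (apply hp; assumption).
  assert (dr : ex_derive (Derive rho0) X) by (apply hrho0; assumption).
  assert (dr0 : ex_derive rho0 X) by (apply hrho0; assumption).
  assert (d1 : ex_derive (fun Y => ln (Derive xp Y) - ln (Derive x0 Y)) X)
    by (auto_derive; repeat split; assumption).
  assert (d2 : ex_derive (fun Y => (Derive rho0 Y * / Derive xp Y) ^ 2) X)
    by (auto_derive; repeat split; try assumption; lra).
  assert (d3 : ex_derive (fun Y => F (rho0 Y)) X)
    by (unfold F; auto_derive; repeat split; assumption).
  apply Derive_correct in d1, d2, d3.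
  assert (hd := is_derive_minus _ _ _ _ _
    (is_derive_plus _ _ _ _ _
       (is_derive_scal _ _ (- (eta * dt)) _ d1)
       (is_derive_scal _ _ (eps ^ 2 / 2) _ d2)) d3).
  replace (- kinetic dt r M rho0 xm x0 xp X) with
    (- (eta * dt)
     * Derive (fun Y => ln (Derive xp Y) - ln (Derive x0 Y)) X
     + eps ^ 2 / 2
       * Derive (fun Y => (Derive rho0 Y * / Derive xp Y) ^ 2) X
     - Derive (fun Y => F (rho0 Y)) X);
    [exact hd |].
  unfold scheme_at in hs. unfold kinetic.
  lra.
Qed.

(** Integration by parts: the integrand is [- (potential * (xp - x0))'], and the
    two maps agree at the endpoints. *)
Lemma is_RInt_tested_scheme (eps eta dt r : R) (xm x0 xp : R -> R) :
  a < b -> flow_map a b xm -> flow_map a b x0 -> flow_map a b xp ->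
  (forall X, a < X < b -> scheme_at eps eta dt r M rho0 xm x0 xp X) ->
  is_RInt (fun X => kinetic dt r M rho0 xm x0 xp X * (xp X - x0 X)
                    - potential eps eta dt rho0 x0 xp X
                      * (Derive xp X - Derive x0 X)) a b 0.
Proof.
  intros hab hm h0 hp hs.
  set (g := fun X => - (potential eps eta dt rho0 x0 xp X * (xp X - x0 X))).
  replace 0 with (g b - g a).
  2: { unfold g. destruct hp as [_ [-> [-> _]]], h0 as [_ [-> [-> _]]]. ring. }
  apply is_RInt_derive_interior; [assumption | | |].
  - intros X hX. unfold g.
    apply continuous_Ropp, continuous_Rmult;
      [apply continuous_potential; assumption | solve_continuous].
  - intros X hX.
    apply continuous_Rminus; apply continuous_Rmult;
      [ apply continuous_kinetic; assumption | solve_continuous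
      | apply continuous_potential; assumption | solve_continuous ].
  - intros X hX.
    assert (hX' : a <= X <= b) by lra.
    assert (hG := is_derive_potential eps eta dt r xm x0 xp X h0 hp hX (hs X hX)).
    assert (dp : is_derive xp X (Derive xp X))
      by (apply Derive_correct; apply hp; assumption).
    assert (d0 : is_derive x0 X (Derive x0 X))
      by (apply Derive_correct; apply h0; assumption).
    assert (hd := is_derive_opp _ _ _ (is_derive_mult _ _ _ _ _ hG
      (is_derive_minus _ _ _ _ _ dp d0) Rmult_comm)).
    replace (_ - _) with
      (- (- kinetic dt r M rho0 xm x0 xp X * (xp X - x0 X)
          + potential eps eta dt rho0 x0 xp X
            * (Derive xp X - Derive x0 X)));
      [exact hd |].
    ring.
Qed.

(** The inequality between integrands: [kinetic_increment] weighted by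
    [rho0'^2], added to [energy_density_increment]. *)
Lemma dissipation_density (eps eta dt r rmax : R) (xm x0 xp : R -> R) (X : R) :
  flow_map a b xm -> flow_map a b x0 -> flow_map a b xp -> a <= X <= b ->
  0 < dt -> 0 < r <= rmax -> rmax <= 3 / 2 ->
  (eps ^ 2 / 2 * Rabs (Derive rho0 X * / Derive xp X) ^ 2 + F (rho0 X))
    * Derive xp X
  + rmax / (2 * dt * (rmax + 1))
    * (Derive rho0 X ^ 2 * (/ ell M rho0 xp X + / ell M rho0 x0 X)
       * (xp X - x0 X) * (xp X - x0 X))
  + eta * dt * ((ln (Derive xp X) - ln (Derive x0 X))
                * (Derive xp X - Derive x0 X))
  <= (eps ^ 2 / 2 * Rabs (Derive rho0 X * / Derive x0 X) ^ 2 + F (rho0 X))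
       * Derive x0 X
     + rmax / (2 * (dt / r) * (rmax + 1))
       * (Derive rho0 X ^ 2 * (/ ell M rho0 xm X + / ell M rho0 x0 X)
          * (x0 X - xm X) * (x0 X - xm X))
     + (kinetic dt r M rho0 xm x0 xp X * (xp X - x0 X)
        - potential eps eta dt rho0 x0 xp X * (Derive xp X - Derive x0 X)).
Proof.
  intros hm h0 hp hX hdt hr hR.
  assert (hE := energy_density_increment eps (Derive rho0 X) (F (rho0 X))
    (Derive xp X) (Derive x0 X)
    ltac:(apply hp; assumption) ltac:(apply h0; assumption)).
  assert (hK := kinetic_increment r rmax dt
    (Rpower (ell M rho0 xp X) (- (1 / 2)))
    (Rpower (ell M rho0 x0 X) (- (1 / 2)))
    (Rpower (ell M rho0 xm X) (- (1 / 2)))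
    (x0 X - xm X) (xp X - x0 X) hdt hr hR).
  apply (Rmult_le_compat_l (Derive rho0 X ^ 2)) in hK; [| apply pow2_ge_0].
  rewrite !Rpower_minus_half_sqr in hK by (apply ell_pos; assumption).
  unfold kinetic, potential.
  unfold Rdiv in *.
  lra.
Qed.

End Interval.

Theorem theorem2p3 (a b eps eta rmax : R) (M rho0 : R -> R)
    (t : nat -> R) (x : nat -> R -> R) (n : nat)
    (hab : a < b) (heps : 0 < eps) (heta : 0 <= eta)
    (hrho0 : regular a b rho0)
    (hM : forall X, a <= X <= b ->
       0 < M (rho0 X) /\ continuous M (rho0 X))
    (hx : forall k, flow_map a b (x k))
    (htau : forall k, (1 <= k)%nat -> 0 < tau t k)
    (hratio : forall k, (2 <= k)%nat -> 0 < ratio t k <= rmax)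
    (hn : (1 <= n)%nat)
    (hscheme : forall X, a < X < b ->
       scheme_at eps eta (tau t (n + 1)) (ratio t (n + 1)) M rho0
         (x (n - 1)%nat) (x n) (x (n + 1)%nat) X)
    (hrmax : 0 < rmax <= 3 / 2) :
  energy a b eps rho0 (x (n + 1)%nat)
  + rmax / (2 * tau t (n + 1) * (rmax + 1))
    * inner a b
        (fun X => Derive rho0 X ^ 2
                  * (/ ell M rho0 (x (n + 1)%nat) X + / ell M rho0 (x n) X)
                  * (x (n + 1)%nat X - x n X))
        (fun X => x (n + 1)%nat X - x n X)
  + eta * tau t (n + 1)
    * inner a b
        (fun X => ln (Derive (x (n + 1)%nat) X) - ln (Derive (x n) X))
        (fun X => Derive (x (n + 1)%nat) X - Derive (x n) X)
  <= energy a b eps rho0 (x n)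
     + rmax / (2 * tau t n * (rmax + 1))
       * inner a b
           (fun X => Derive rho0 X ^ 2
                     * (/ ell M rho0 (x (n - 1)%nat) X + / ell M rho0 (x n) X)
                     * (x n X - x (n - 1)%nat X))
           (fun X => x n X - x (n - 1)%nat X).
Proof.
  set (dt := tau t (n + 1)). set (r := ratio t (n + 1)).
  assert (hdt : 0 < dt) by (apply htau; lia).
  assert (htn : 0 < tau t n) by (apply htau; lia).
  assert (hr : 0 < r <= rmax) by (apply hratio; lia).
  assert (htau_n : tau t n = dt / r).
  { unfold r, ratio. replace (n + 1 - 1)%nat with n by lia. fold dt.
    field. lra. }
  rewrite htau_n.
  assert (hp := hx (n + 1)%nat). assert (h0 := hx n).
  assert (hm := hx (n - 1)%nat).
  fold dt r in hscheme.
  set (xp := x (n + 1)%nat) in *. set (x0 := x n) in *.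
  set (xm := x (n - 1)%nat) in *.
  assert (hzero := is_RInt_tested_scheme a b M rho0 hrho0 hM eps eta dt r
    xm x0 xp hab hm h0 hp hscheme).
  assert (hEp := RInt_correct _ _ _ (ex_RInt_energy a b rho0 hrho0 eps xp hab hp)).
  assert (hE0 := RInt_correct _ _ _ (ex_RInt_energy a b rho0 hrho0 eps x0 hab h0)).
  assert (hKp := RInt_correct _ _ _ (ex_RInt_kinetic_energy a b M rho0 hrho0 hM
    xp x0 xp x0 hab hp h0 hp h0)).
  assert (hK0 := RInt_correct _ _ _ (ex_RInt_kinetic_energy a b M rho0 hrho0 hM
    xm x0 x0 xm hab hm h0 h0 hm)).
  assert (hL := RInt_correct _ _ _ (ex_RInt_log_dissipation a b xp x0 hab hp h0)).
  assert (hlhs := is_RInt_plus _ _ _ _ _ _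
    (is_RInt_plus _ _ _ _ _ _ hEp
       (is_RInt_scal _ _ _ (rmax / (2 * dt * (rmax + 1))) _ hKp))
    (is_RInt_scal _ _ _ (eta * dt) _ hL)).
  assert (hrhs := is_RInt_plus _ _ _ _ _ _
    (is_RInt_plus _ _ _ _ _ _ hE0
       (is_RInt_scal _ _ _ (rmax / (2 * (dt / r) * (rmax + 1))) _ hK0))
    hzero).
  rewrite <- (Rplus_0_r (energy a b eps rho0 x0 + _)).
  apply (is_RInt_le _ _ a b _ _ (Rlt_le _ _ hab) hlhs hrhs).
  intros X hX.
  exact (dissipation_density a b M rho0 hM eps eta dt r rmax xm x0 xp X
    hm h0 hp ltac:(lra) hdt hr (proj2 hrmax)).
Qed.
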